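(* Let $\mathcal O\in\mathrm{Op}^{\mathrm{un}}$ be a unital $\infty$-operad and for $k\ge1$ write $\mathrm{R}_k\mathcal O:=\mathrm{R}_k((\mathcal O)^k)$, with the canonical co-filtration $\mathcal O\to\cdots\to\mathrm{R}_k\mathcal O\to\cdots\to\mathrm{R}_2\mathcal O\to\mathrm{R}_1\mathcal O$. Then the canonical map $$\mathcal O\to\lim_{k\in\mathbb N_{\ge1}}\mathrm{R}_k\mathcal O$$ is an equivalence.
   Context: **Trees.** A (dendroidal) tree $(T,L)$, often written $T$, is a finite poset $T$ with a minimal element (a least element, called the root) such that $\{y\le x\}$ is linearly ordered for every $x\in T$, together with a subset $L$ of the maximal elements of $T$ (the leaves). Elements of $T$ are called edges. For an edge $e$, $v(e)$ is the set of minimal elements of $T_{>e}$, and $|v(e)|$ is the valence of $e$. The edge $\eta$ is $(\{r\},\{r\})$; the $n$-corolla $C_n$ ($n\ge1$) is $\{0,1,\dots,n\}$ with $0$ least, $1,\dots,n$ pairwise incomparable and $L=\{1,\dots,n\}$; $C_0=(\{0\},\varnothing)$. **Category $\Omega$.** Objects are trees; $\mathrm{Hom}_\Omega(T,T')$ is the set of operad maps $\mathrm{Free}(T)\to\mathrm{Free}(T')$, where $\mathrm{Free}(T)$ is the coloured symmetric operad in sets with colours the edges of $T$, freely generated by one operation $v(e)\to e$ for each non-leaf edge $e$. **Closed trees.** A tree is closed if $L=\varnothing$; $\Omega^c\subset\Omega$ is the full subcategory of closed trees. (Explicitly: objects are finite rooted trees and morphisms are order-preserving maps that preserve independence, i.e.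 send incomparable pairs to incomparable pairs.) The inclusion $\Omega^c\hookrightarrow \Omega$ has left adjoint $(T,L)^c=(T,\varnothing)$. A tree is $k$-dendroidal if all its edges have valence $\le k$ (no condition if $k=\infty$); $\Omega^c_{\le k}\subset\Omega^c$ is the full subcategory of closed $k$-dendroidal trees, $\Omega^c_{\le\infty}=\Omega^c$. **Segal presheaves.** $\mathcal S$ is the $\infty$-category of spaces and $\mathcal P(\mathcal C)=\mathrm{Fun}(\mathcal C^{\mathrm{op}},\mathcal S)$. A morphism $f\colon T\to T'$ is a subtree inclusion if it is injective on edges and whenever $f(e_0)\le e'\le f(e_2)$ with $e'\in T'$, $e'$ lies in the image of $f$. For a tree $T$, $(\Omega^{\mathrm{el}})_{/T}\subset\Omega_{/T}$ is the full subcategory of subtree inclusions $f\colon X\to T$ with $X=\eta$ or $X=C_n$ for some $n$, where, if $X=C_n$ has root $x$, the edge $f(x)$ must also have valence $n$. A presheaf $\mathcal F$ on $\Omega^c_{\le k}$ is Segal if for every closed $k$-dendroidal $T$ the canonical map $\mathcal F(T)\to\lim_{X\in((\Omega^{\mathrm{el}})_{/T})^{\mathrm{op}}}\mathcal F(X^c)$ is an equivalence. Let $r\colon\Delta\to\Omega^c_{\le k}$ send $[n]$ to the closure of $(\{0\le1\le\dots\le n\},\{n\})$. A Segal presheaf $\mathcal F$ is complete if $r^*\mathcal F$ is a complete Segal space in the sense of Rezk. **Operads.** $\mathrm{Op}^{\mathrm{un}}_{\le k}$ is the full subcategory of $\mathcal P(\Omega^c_{\le k})$ on complete Segal presheaves;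 $\mathrm{Op}^{\mathrm{un}}=\mathrm{Op}^{\mathrm{un}}_{\le\infty}$ (equivalent to the $\infty$-category of unital $\infty$-operads). $(-)^k=i_k^*\colon\mathrm{Op}^{\mathrm{un}}\to\mathrm{Op}^{\mathrm{un}}_{\le k}$ is restriction along $i_k\colon\Omega^c_{\le k}\hookrightarrow\Omega^c$; $\mathrm{R}_k\colon\mathrm{Op}^{\mathrm{un}}_{\le k}\to\mathrm{Op}^{\mathrm{un}}$ is its fully faithful right adjoint, given by right Kan extension along $i_k$. The maps in the co-filtration are induced by the units of these adjunctions. *)

(* Defs.v *)
From HB Require Import structures.
From mathcomp Require Import all_boot all_order.
From mathcomp Require Import boolp.
From Stdlib Require Import Relation_Operators.
Set Implicit Arguments.
Unset Strict Implicit.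
Unset Printing Implicit Defensive.

Import Order.TTheory.

(* The infinity-category P(C) of presheaves of spaces on an ordinary category
   C is presented by strict functors from C^op to Kan complexes; every functor
   from N(C)^op to spaces rectifies to one of these, uniquely up to levelwise
   homotopy equivalence, and equivalences in P(C) are the levelwise homotopy
   equivalences.  Limits and right Kan extensions are homotopy limits and
   homotopy right Kan extensions, by the Bousfield-Kan formula; for diagrams
   of Kan complexes these compute the infinity-categorical ones. *)

Record category := Category {
  ob :> Type;
  hom : ob -> ob -> Type;
  idm : forall x, hom x x;
  mcomp : forall x y z, hom y z -> hom x y -> hom x z;
  comp1m : forall x y (f : hom x y), mcomp (idm y) f = f;
  compm1 : forall x y (f : hom x y), mcomp f (idm x) = f;
  compA : forall x y z t (h : hom z t) (g : hom y z) (f : hom x y),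
    mcomp h (mcomp g f) = mcomp (mcomp h g) f }.

Record functor (C D : category) := Functor {
  fob :> C -> D;
  fmap : forall x y, hom x y -> hom (fob x) (fob y);
  fmap_id : forall x, fmap (idm x) = idm (fob x);
  fmap_comp : forall x y z (g : hom y z) (f : hom x y),
    fmap (mcomp g f) = mcomp (fmap g) (fmap f) }.

Definition op (C : category) : category :=
  @Category C (fun x y => @hom C y x) (@idm C)
    (fun x y z g f => mcomp f g)
    (fun x y f => compm1 f) (fun x y f => comp1m f)
    (fun x y z t h g f => esym (compA f g h)).

Definition fop (C D : category) (u : functor C D) : functor (op C) (op D) :=
  @Functor (op C) (op D) u (fun x y f => fmap u f) (fmap_id u)
    (fun x y z g f => fmap_comp u f g).

Definition idfunctor (C : category) : functor C C :=
  @Functor C C (fun x => x) (fun x y f => f)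
    (fun x => erefl) (fun x y z g f => erefl).

#[projections(primitive)]
Record fsob (C : category) (P : C -> Prop) := FsOb {
  fsval :> C;
  fsP : P fsval }.

Definition fullsub (C : category) (P : C -> Prop) : category :=
  @Category (fsob P) (fun x y => hom (fsval x) (fsval y))
    (fun x => idm (fsval x)) (fun x y z g f => mcomp g f)
    (fun x y f => comp1m f) (fun x y f => compm1 f)
    (fun x y z t h g f => compA h g f).

Definition incl (C : category) (P : C -> Prop) : functor (fullsub P) C :=
  @Functor (fullsub P) C (@fsval C P) (fun x y f => f)
    (fun x => erefl) (fun x y z g f => erefl).

Definition widen (C : category) (P Q : C -> Prop)
    (PQ : forall x, P x -> Q x) : functor (fullsub P) (fullsub Q) :=
  @Functor (fullsub P) (fullsub Q)
    (fun x => FsOb (PQ (fsval x) (fsP x))) (fun x y f => f)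
    (fun x => erefl) (fun x y z g f => erefl).

Record slice_ob (C : category) (c : C) := SliceOb {
  slice_src : C;
  slice_map : hom slice_src c }.

Record over_hom (C : category) (c : C) (x y : slice_ob c) := OverHom {
  over_map : hom (slice_src x) (slice_src y);
  over_comm : mcomp (slice_map y) over_map = slice_map x }.

Lemma over_hom_eq (C : category) (c : C) (x y : slice_ob c)
    (f g : over_hom x y) :
  over_map f = over_map g -> f = g.
Proof.
case: f g => f Pf [g Pg] /= e; subst g.
by congr OverHom; exact: Prop_irrelevance.
Qed.

Lemma over_comm_comp (C : category) (c : C) (x y z : slice_ob c)
    (g : over_hom y z) (f : over_hom x y) :
  mcomp (slice_map z) (mcomp (over_map g) (over_map f)) = slice_map x.
Proof. by rewrite compA !over_comm. Qed.

Definition slice (C : category) (c : C) : category.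
Proof.
refine (@Category (slice_ob c) (@over_hom C c)
  (fun x => OverHom (compm1 (slice_map x)))
  (fun x y z g f => OverHom (over_comm_comp g f)) _ _ _).
- by move=> x y f; apply: over_hom_eq; exact: comp1m.
- by move=> x y f; apply: over_hom_eq; exact: compm1.
- by move=> x y z t h g f; apply: over_hom_eq; exact: compA.
Defined.

Definition fullfam (C : category) (A : Type) (g : A -> C) : category :=
  @Category A (fun x y => hom (g x) (g y))
    (fun x => idm (g x)) (fun x y z h f => mcomp h f)
    (fun x y f => comp1m f) (fun x y f => compm1 f)
    (fun x y z t k h f => compA k h f).

Definition monotone m n (f : 'I_m.+1 -> 'I_n.+1) : Prop :=
  forall a b : 'I_m.+1, a <= b -> f a <= f b.

#[projections(primitive)]
Record delta_hom m n := DeltaHom {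
  delta_fun :> 'I_m.+1 -> 'I_n.+1;
  delta_mono : monotone delta_fun }.

Definition delta_id n : delta_hom n n :=
  @DeltaHom n n (fun a => a) (fun a b h => h).

Definition delta_comp m n p (g : delta_hom n p) (f : delta_hom m n) :
  delta_hom m p :=
  @DeltaHom m p (fun a => g (f a))
    (fun a b h => delta_mono g (delta_mono f h)).

(* The simplex category; the object n stands for [n] = {0 < ... < n}. *)
Definition Delta : category :=
  @Category nat delta_hom delta_id delta_comp
    (fun m n f => erefl) (fun m n f => erefl)
    (fun m n p q h g f => erefl).

Lemma delta_hom_eq m n (f g : delta_hom m n) : f =1 g -> f = g.
Proof.
case: f g => f Pf [g Pg] /= /funext e; subst g.
by congr DeltaHom; exact: Prop_irrelevance.
Qed.

Lemma monotone_cst m n (i : 'I_n.+1) : @monotone m n (fun=> i).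
Proof. by []. Qed.

Definition cst_map m n (i : 'I_n.+1) : delta_hom m n :=
  @DeltaHom m n (fun=> i) (@monotone_cst m n i).

Lemma delta_comp_cst m n p (f : delta_hom m n) (i : 'I_m.+1) :
  delta_comp f (@cst_map p m i) = cst_map p (f i).
Proof. exact: delta_hom_eq. Qed.

Lemma cst_comp_delta m n p (f : delta_hom m n) (i : 'I_p.+1) :
  delta_comp (cst_map n i) f = cst_map m i.
Proof. exact: delta_hom_eq. Qed.

Lemma monotone_lift n (i : 'I_n.+2) : @monotone n n.+1 (lift i).
Proof. by move=> a b h; rewrite /= leq_bump2. Qed.

(* The i-th coface map, whose image misses i. *)
Definition coface n (i : 'I_n.+2) : delta_hom n n.+1 :=
  @DeltaHom n n.+1 (lift i) (@monotone_lift n i).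

Record sset := SSet {
  simp :> nat -> Type;
  sact : forall m n, delta_hom m n -> simp n -> simp m;
  sact_id : forall n (x : simp n), sact (delta_id n) x = x;
  sact_comp : forall m n p (g : delta_hom n p) (f : delta_hom m n)
    (x : simp p), sact (delta_comp g f) x = sact f (sact g x) }.

Record smap (X Y : sset) := SMap {
  smap_fun :> forall n, X n -> Y n;
  smap_nat : forall m n (f : delta_hom m n) (x : X n),
    smap_fun (sact f x) = sact f (smap_fun x) }.

Definition sidm (X : sset) : smap X X :=
  @SMap X X (fun n x => x) (fun m n f x => erefl).

Definition scomp (X Y Z : sset) (g : smap Y Z) (f : smap X Y) : smap X Z.
Proof.
refine (@SMap X Z (fun n x => g n (f n x)) _).
by move=> m n h x; rewrite !smap_nat.
Defined.

(* The simplices of the representable Delta^n lying in the k-th horn: those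
   whose image misses some vertex other than k. *)
Definition in_horn n (k : 'I_n.+1) m (f : delta_hom m n) : Prop :=
  exists2 i : 'I_n.+1, i != k & forall a, f a != i.

Definition kan (X : sset) : Prop :=
  forall n (k : 'I_n.+2)
    (h : forall m (f : delta_hom m n.+1), in_horn k f -> X m),
  (forall m m' (f : delta_hom m n.+1) (g : delta_hom m' m)
     (Hf : in_horn k f) (Hfg : in_horn k (delta_comp f g)),
     h m' (delta_comp f g) Hfg = sact g (h m f Hf)) ->
  exists x : X n.+1, forall m (f : delta_hom m n.+1) (Hf : in_horn k f),
    h m f Hf = sact f x.

(* H is a map X x Delta^1 -> Y restricting to f at 0 and to g at 1. *)
Definition shomotopy (X Y : sset) (f g : smap X Y) : Prop :=
  exists H : forall n, X n -> delta_hom n 1 -> Y n,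
  [/\ forall m n (s : delta_hom m n) (x : X n) (t : delta_hom n 1),
        H m (sact s x) (delta_comp t s) = sact s (H n x t),
      forall n x, H n x (@cst_map n 1 ord0) = f n x
    & forall n x, H n x (@cst_map n 1 ord_max) = g n x].

Definition homotopic (X Y : sset) : smap X Y -> smap X Y -> Prop :=
  clos_refl_sym_trans _ (@shomotopy X Y).

(* Only used between Kan complexes, where it is equivalence of spaces. *)
Definition hequiv (X Y : sset) (f : smap X Y) : Prop :=
  exists g : smap Y X,
    homotopic (scomp g f) (sidm X) /\ homotopic (scomp f g) (sidm Y).

Record diagram (J : category) := Diagram {
  dob :> J -> sset;
  dmap : forall i j, hom i j -> smap (dob i) (dob j);
  dmap_id : forall i n (x : dob i n), dmap (idm i) n x = x;
  dmap_comp : forall i j k (g : hom j k) (f : hom i j) n (x : dob i n),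
    dmap (mcomp g f) n x = dmap g n (dmap f n x) }.

Record dmor (J : category) (D E : diagram J) := DMor {
  dmor_fun :> forall j, smap (D j) (E j);
  dmor_nat : forall i j (f : hom i j) n (x : D i n),
    dmor_fun j n (dmap D f n x) = dmap E f n (dmor_fun i n x) }.

Definition dpull (J' J : category) (u : functor J' J) (D : diagram J) :
  diagram J'.
Proof.
refine (@Diagram J' (fun j => D (u j)) (fun i j f => dmap D (fmap u f)) _ _).
- by move=> i n x; rewrite fmap_id dmap_id.
- by move=> i j k g f n x; rewrite fmap_comp dmap_comp.
Defined.

Record weight (J : category) := Weight {
  wob :> J -> Type;
  wmap : forall i j, hom i j -> wob i -> wob j;
  wmap_id : forall i (x : wob i), wmap (idm i) x = x;
  wmap_comp : forall i j k (g : hom j k) (f : hom i j) (x : wob i),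
    wmap (mcomp g f) x = wmap g (wmap f x) }.

Record wmor (J : category) (H K : weight J) := WMor {
  wmor_fun :> forall j, H j -> K j;
  wmor_nat : forall i j (f : hom i j) (x : H i),
    wmor_fun (wmap f x) = wmap f (wmor_fun x) }.
Arguments wmor_fun {J H K} _ j _.

Definition wpull (J' J : category) (u : functor J' J) (H : weight J) :
  weight J'.
Proof.
refine (@Weight J' (fun j => H (u j)) (fun i j f => wmap (fmap u f)) _ _).
- by move=> i x; rewrite fmap_id wmap_id.
- by move=> i j k g f x; rewrite fmap_comp wmap_comp.
Defined.

Definition wone (J : category) : weight J :=
  @Weight J (fun=> unit) (fun _ _ _ x => x)
    (fun _ _ => erefl) (fun _ _ _ _ _ _ => erefl).

(* The p-simplices of B(H)(j), where B(H) is the bar resolution of H : J -> Set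
   in simplicial functors on J: chains s_0 -> ... -> s_p -> j in J with
   an element of H(s_0), recorded together with its images in all H(s_a) (and
   all composites of the chain).  B(H)(j) is the disjoint union over x in H(j)
   of the nerves of the slices el(H)/(j,x) of the category of elements of H;
   for H = 1 it is the nerve of J/j. *)
#[projections(primitive)]
Record bar (J : category) (H : weight J) (j : J) (p : nat) := Bar {
  bob : 'I_p.+1 -> J;
  bmor : forall a b : 'I_p.+1, a <= b -> hom (bob a) (bob b);
  belt : forall a, H (bob a);
  bcone : forall a, hom (bob a) j;
  bmor_id : forall (a : 'I_p.+1) (h : a <= a), bmor h = idm (bob a);
  bmor_comp : forall (a b c : 'I_p.+1) (hab : a <= b) (hbc : b <= c)
    (hac : a <= c), bmor hac = mcomp (bmor hbc) (bmor hab);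
  belt_nat : forall (a b : 'I_p.+1) (h : a <= b),
    wmap (bmor h) (belt a) = belt b;
  bcone_nat : forall (a b : 'I_p.+1) (h : a <= b),
    mcomp (bcone b) (bmor h) = bcone a }.

Lemma Bar_eq (J : category) (H : weight J) (j : J) p (s : 'I_p.+1 -> J)
    (mor : forall a b : 'I_p.+1, a <= b -> hom (s a) (s b))
    (elt elt' : forall a, H (s a)) (cone cone' : forall a, hom (s a) j)
    m1 m2 e1 c1 m1' m2' e1' c1' :
  (forall a, elt a = elt' a) -> (forall a, cone a = cone' a) ->
  @Bar J H j p s mor elt cone m1 m2 e1 c1 =
  @Bar J H j p s mor elt' cone' m1' m2' e1' c1'.
Proof.
move=> ee ec.
have ? : elt = elt' by exact: functional_extensionality_dep.
have ? : cone = cone' by exact: functional_extensionality_dep.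
by subst; congr Bar; exact: Prop_irrelevance.
Qed.

Definition bar_act (J : category) (H : weight J) (j : J) p q
    (s : delta_hom q p) (b : bar H j p) : bar H j q :=
  @Bar J H j q
    (fun a => bob b (s a))
    (fun a a' h => bmor b (delta_mono s h))
    (fun a => belt b (s a))
    (fun a => bcone b (s a))
    (fun a h => bmor_id b _)
    (fun a a' a'' h h' h'' => bmor_comp b _ _ _)
    (fun a a' h => belt_nat b _)
    (fun a a' h => bcone_nat b _).

Definition bar_push (J : category) (H : weight J) (j j' : J) (f : hom j j') p
    (b : bar H j p) : bar H j' p.
Proof.
refine (@Bar J H j' p (bob b) (fun a a' h => bmor b h) (belt b)
  (fun a => mcomp f (bcone b a)) (fun a h => bmor_id b h)
  (fun a a' a'' h h' h'' => bmor_comp b h h' h'')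
  (fun a a' h => belt_nat b h) _).
by move=> a a' h; rewrite -compA bcone_nat.
Defined.

Definition bar_map (J' J : category) (u : functor J' J) (H' : weight J')
    (H : weight J) (f : wmor H' (wpull u H)) (j : J') p (b : bar H' j p) :
  bar H (u j) p.
Proof.
refine (@Bar J H (u j) p (fun a => u (bob b a))
  (fun a a' h => fmap u (bmor b h)) (fun a => f _ (belt b a))
  (fun a => fmap u (bcone b a)) _ _ _ _).
- by move=> a h; rewrite bmor_id fmap_id.
- by move=> a a' a'' h h' h''; rewrite (bmor_comp b h h') fmap_comp.
- by move=> a a' h; rewrite -(belt_nat b h) wmor_nat.
- by move=> a a' h; rewrite -fmap_comp bcone_nat.
Defined.

(* The weighted homotopy limit of D, i.e. the homotopy limit over the category
   of elements el(H) of D restricted to el(H): the simplicial set of natural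
   maps B(H) -> D, with n-simplices the natural maps
   B(H)(j) x Delta^n -> D(j). *)
Definition whlim_natural (J : category) (H : weight J) (D : diagram J) n
    (phi : forall j p, bar H j p -> delta_hom p n -> D j p) : Prop :=
  (forall j p q (s : delta_hom q p) b t,
     phi j q (bar_act s b) (delta_comp t s) = sact s (phi j p b t)) /\
  (forall j j' (f : hom j j') p b t,
     phi j' p (bar_push f b) t = dmap D f p (phi j p b t)).

Definition whlim_simp (J : category) (H : weight J) (D : diagram J) n : Type :=
  {phi : forall j p, bar H j p -> delta_hom p n -> D j p |
     whlim_natural phi}.

Lemma whlim_eq (J : category) (H : weight J) (D : diagram J) n
    (x y : whlim_simp H D n) :
  (forall j p b t, sval x j p b t = sval y j p b t) -> x = y.
Proof.
case: x y => x xP [y yP] /= e; apply: eq_exist.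
by do 4 apply: functional_extensionality_dep => ?.
Qed.

Lemma whlim_act_natural (J : category) (H : weight J) (D : diagram J) m n
    (s : delta_hom m n) (x : whlim_simp H D n) :
  @whlim_natural J H D m
    (fun j p b t => sval x j p b (delta_comp s t)).
Proof.
case: x => phi [nat1 nat2]; split=> /= [j p q s' b t|j j' f p b t].
- exact: (nat1 j p q s' b (delta_comp s t)).
- by rewrite nat2.
Qed.

Definition whlim_act (J : category) (H : weight J) (D : diagram J) m n
    (s : delta_hom m n) (x : whlim_simp H D n) : whlim_simp H D m :=
  exist _ _ (whlim_act_natural s x).

Definition whlim (J : category) (H : weight J) (D : diagram J) : sset.
Proof.
refine (@SSet (whlim_simp H D) (@whlim_act J H D) _ _).
- by move=> n x; apply: whlim_eq.
- by move=> m n p g f x; apply: whlim_eq.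
Defined.

Definition holim (J : category) (D : diagram J) : sset := whlim (wone J) D.

Section WhlimMap.
Variables (J' J : category) (u : functor J' J).
Variables (H : weight J) (D : diagram J) (H' : weight J') (D' : diagram J').
Variables (f : wmor H' (wpull u H)) (g : dmor (dpull u D) D').

Lemma whlim_map_natural n (x : whlim_simp H D n) :
  @whlim_natural J' H' D' n
    (fun j p b t => g j p (sval x (u j) p (bar_map f b) t)).
Proof.
case: x => phi [nat1 nat2]; split=> /= [j p q s b t|j j' h p b t].
- by rewrite -smap_nat -nat1.
- apply: etrans (dmor_nat g h (phi (u j) p (bar_map f b) t)).
  rewrite /= -nat2; congr (g _ _ (phi _ _ _ _)).
  by apply: Bar_eq => //= a; rewrite fmap_comp.
Qed.

Definition whlim_map : smap (whlim H D) (whlim H' D').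
Proof.
refine (@SMap (whlim H D) (whlim H' D')
  (fun n x => exist _ _ (whlim_map_natural x)) _).
by move=> m n s x; apply: whlim_eq.
Defined.

End WhlimMap.

(* The map induced by a weighted cone X -> D(j), indexed by the elements of
   H(j): constant along the bar resolution. *)
Section ToWhlim.
Variables (J : category) (H : weight J) (D : diagram J) (X : sset).
Variable c : forall j, H j -> smap X (D j).
Hypothesis cE : forall i j (f : hom i j) (h : H i) n (x : X n),
  c (wmap f h) n x = dmap D f n (c h n x).

(* The image in H(j) of the element carried by a bar simplex. *)
Definition bar_aug j p (b : bar H j p) : H j :=
  wmap (bcone b ord0) (belt b ord0).

Lemma bar_augE j p (b : bar H j p) a : wmap (bcone b a) (belt b a) = bar_aug b.
Proof.
rewrite /bar_aug -(belt_nat b (leq0n a : ord0 <= a)) -wmap_comp.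
by rewrite bcone_nat.
Qed.

Lemma to_whlim_natural n (x : X n) :
  @whlim_natural J H D n (fun j p b t => c (bar_aug b) p (sact t x)).
Proof.
split=> /= [j p q s b t|j j' f p b t].
- rewrite -smap_nat -(sact_comp t s) -(bar_augE b (s ord0)).
  by rewrite {1}/bar_aug.
- by rewrite -cE /bar_aug /= wmap_comp.
Qed.

Definition to_whlim : smap X (whlim H D).
Proof.
refine (@SMap X (whlim H D) (fun n x => exist _ _ (to_whlim_natural x)) _).
move=> m n s x; apply: whlim_eq => j p b t /=.
by rewrite -(sact_comp s t).
Defined.

End ToWhlim.

Section ToHolim.
Variables (J : category) (D : diagram J) (X : sset).
Variable c : forall j, smap X (D j).
Hypothesis cE : forall i j (f : hom i j) n (x : X n),
  c j n x = dmap D f n (c i n x).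

Definition to_holim : smap X (holim D) :=
  @to_whlim J (wone J) D X (fun j _ => c j) (fun i j f _ n x => cE f x).

End ToHolim.

Definition psh (C : category) : Type := diagram (op C).

Definition psh_equiv (C : category) (F G : psh C) (f : dmor F G) : Prop :=
  forall c : C, hequiv (f c).

Definition dident (J : category) (D : diagram J) : dmor D D :=
  @DMor J D D (fun j => sidm (D j)) (fun i j f n x => erefl).

(* (ran i F)(d) is the homotopy limit of F(c) over all pairs of c : C and
   i c -> d, written as a homotopy limit weighted by Hom(i -, d). *)
Section RightKanExtension.
Variables (C D : category) (i : functor C D).

Definition hom_weight (d : D) : weight (op C).
Proof.
refine (@Weight (op C) (fun c => hom (i c) d)
  (fun c c' f h => mcomp h (fmap i f)) _ _).
- by move=> c h; rewrite fmap_id compm1.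
- by move=> c c' c'' g f h; rewrite fmap_comp compA.
Defined.

Definition hom_weight_map (d d' : D) (g : hom d d') :
  wmor (hom_weight d) (wpull (idfunctor (op C)) (hom_weight d')).
Proof.
refine (@WMor (op C) (hom_weight d) (wpull (idfunctor (op C)) (hom_weight d'))
  (fun c h => mcomp g h) _).
by move=> c c' f h; rewrite /= compA.
Defined.

Definition dpull_id (J : category) (E : diagram J) :
    dmor (dpull (idfunctor J) E) E :=
  @DMor J (dpull (idfunctor J) E) E (fun j => sidm (E j))
    (fun i j f n x => erefl).

Definition ran (F : psh C) : psh D.
Proof.
refine (@Diagram (op D) (fun d => whlim (hom_weight d) F)
  (fun d d' (g : @hom D d' d) => whlim_map (hom_weight_map g) (dpull_id F)) _ _).
- move=> d n x; apply: whlim_eq => c p b t /=; congr (sval x c p _ t).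
  by case: b => *; apply: Bar_eq => //= a; rewrite comp1m.
- move=> d d' d'' g f n x; apply: whlim_eq => c p b t /=.
  by congr (sval x c p _ t); apply: Bar_eq => //= a; rewrite compA.
Defined.

Definition ran_unit_cone (F : psh D) (d : D) (c : op C) (h : hom_weight d c) :
    smap (F d) (dpull (fop i) F c) :=
  @dmap (op D) F d (i c) h.

Lemma ran_unit_coneE (F : psh D) (d : D) (c c' : op C) (f : hom c c')
    (h : hom_weight d c) n (x : F d n) :
  ran_unit_cone F (wmap f h) n x =
  dmap (dpull (fop i) F) f n (ran_unit_cone F h n x).
Proof. exact: (@dmap_comp (op D) F d (i c) (i c') (fmap i f) h). Qed.

Definition ran_unit (F : psh D) : dmor F (ran (dpull (fop i) F)).
Proof.
refine (@DMor (op D) F (ran (dpull (fop i) F))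
  (fun d => to_whlim (@ran_unit_coneE F d)) _).
move=> d d' f n x; apply: whlim_eq => c p b t.
rewrite /= -smap_nat /ran_unit_cone.
rewrite -(@dmap_comp (op D) F d d' (i c)); congr (@dmap (op D) F d (i c) _ p _).
exact: (@compA D _ _ _ _ f (belt b ord0) (fmap i (bcone b ord0))).
Defined.

End RightKanExtension.

(* Inclusions of full subcategories defined by P => Q give a map from the right
   Kan extension along incl Q to the one along incl P, by restricting the
   indexing of the homotopy limits.  It commutes strictly with the units; up to
   homotopy it is the unique map under F, as ran along incl P is local for
   presheaf maps that are equivalences on P. *)
Section Restriction.
Variables (C : category) (P Q : C -> Prop) (PQ : forall x, P x -> Q x).
Variable F : psh C.

Definition ran_sub (R : C -> Prop) : psh C :=
  ran (incl R) (dpull (fop (incl R)) F).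

Definition widen_weight (c : C) :
    wmor (hom_weight (incl P) c)
      (wpull (fop (widen PQ)) (hom_weight (incl Q) c)) :=
  @WMor (op (fullsub P)) (hom_weight (incl P) c)
    (wpull (fop (widen PQ)) (hom_weight (incl Q) c))
    (fun x h => h) (fun x y f h => erefl).

Definition widen_dmor :
    dmor (dpull (fop (widen PQ)) (dpull (fop (incl Q)) F))
      (dpull (fop (incl P)) F) :=
  @DMor (op (fullsub P)) (dpull (fop (widen PQ)) (dpull (fop (incl Q)) F))
    (dpull (fop (incl P)) F)
    (fun x => sidm (F x)) (fun x y f n h => erefl).

Definition ran_restrict : dmor (ran_sub Q) (ran_sub P).
Proof.
refine (@DMor (op C) (ran_sub Q) (ran_sub P)
  (fun c => whlim_map (widen_weight c) widen_dmor) _).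
move=> c c' f n x; apply: whlim_eq => y p b t /=.
by congr (sval x (@widen C P Q PQ y) p _ t); apply: Bar_eq.
Defined.

End Restriction.

Record psh_diagram (J C : category) := PshDiagram {
  pdob :> J -> psh C;
  pdmap : forall i j, hom i j -> dmor (pdob i) (pdob j);
  pdmap_id : forall i c n (x : pdob i c n), pdmap (idm i) c n x = x;
  pdmap_comp : forall i j k (g : hom j k) (f : hom i j) c n (x : pdob i c n),
    pdmap (mcomp g f) c n x = pdmap g c n (pdmap f c n x) }.

Section PshHolim.
Variables (J C : category) (G : psh_diagram J C).

Definition pd_at (c : C) : diagram J :=
  @Diagram J (fun j => G j c) (fun i j f => pdmap G f c)
    (fun i => @pdmap_id J C G i c) (fun i j k g f => @pdmap_comp J C G i j k g f c).

Definition pd_at_map (c c' : C) (f : hom c' c) :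
  dmor (dpull (idfunctor J) (pd_at c)) (pd_at c').
Proof.
refine (@DMor J (dpull (idfunctor J) (pd_at c)) (pd_at c')
  (fun j => @dmap (op C) (G j) c c' f) _).
by move=> i j h n x; rewrite /= dmor_nat.
Defined.

Definition wone_id : wmor (wone J) (wpull (idfunctor J) (wone J)) :=
  @WMor J (wone J) (wpull (idfunctor J) (wone J)) (fun j x => x)
    (fun i j f x => erefl).

Lemma bar_map_wone_id j p (b : bar (wone J) j p) : bar_map wone_id b = b.
Proof. by case: b => *; apply: Bar_eq. Qed.

Definition psh_holim : psh C.
Proof.
refine (@Diagram (op C) (fun c => holim (pd_at c))
  (fun c c' f => whlim_map wone_id (pd_at_map f)) _ _).
- move=> c n x; apply: whlim_eq => j p b t /=.
  by rewrite dmap_id bar_map_wone_id.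
- move=> c c' c'' g f n x; apply: whlim_eq => j p b t /=.
  by rewrite dmap_comp !bar_map_wone_id.
Defined.

Variables (F : psh C) (u : forall j, dmor F (G j)).
Hypothesis uE : forall i j (f : hom i j) c n (x : F c n),
  u j c n x = pdmap G f c n (u i c n x).

Definition to_psh_holim : dmor F psh_holim.
Proof.
refine (@DMor (op C) F psh_holim
  (fun c => @to_holim J (pd_at c) (F c) (fun j => u j c)
     (fun i j f n x => uE f x)) _).
move=> c c' f n x; apply: whlim_eq => j p b t /=.
by rewrite -smap_nat dmor_nat.
Defined.

End PshHolim.

Record tree := Tree {
  edge_disp : Order.disp_t;
  edge :> finPOrderType edge_disp;
  leaves : {set edge};
  tree_root : exists r : edge, forall x, (r <= x)%O;
  tree_chain : forall x y z : edge, (y <= x)%O -> (z <= x)%O -> (y >=< z)%O;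
  leaves_max : forall l x : edge, l \in leaves -> (l <= x)%O -> x = l }.

Definition up (T : tree) (e : T) : {set T} :=
  [set x : T | (e < x)%O && [forall y : T, (e < y)%O && (y <= x)%O ==> (y == x)]].

Definition valence (T : tree) (e : T) : nat := #|up e|.

(* Free(T) has at most one operation of each signature (the inputs and the
   output determine the subtree it is composed along), so it is encoded by the
   relation "there is an operation s -> e": the smallest one containing the
   identities and the generators up e -> e and closed under grafting and under
   permutations of the inputs. *)
Inductive free_op (T : tree) : seq T -> T -> Prop :=
| free_id e : free_op [:: e] e
| free_graft e (s : T -> seq T) :
    e \notin leaves T -> (forall x, x \in up e -> free_op (s x) x) ->
    free_op (flatten [seq s x | x <- enum (up e)]) e
| free_perm s t e : perm_eq s t -> free_op s e -> free_op t e.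

(* By the same remark, an operad map is a map of colours preserving the
   existence of operations. *)
Definition operad_map (T U : tree) (f : T -> U) : Prop :=
  forall s e, free_op s e -> free_op (map f s) (f e).

#[projections(primitive)]
Record omega_hom (T U : tree) := OmegaHom {
  omega_fun :> T -> U;
  omega_map : operad_map omega_fun }.

Lemma omega_hom_eq (T U : tree) (f g : omega_hom T U) : f =1 g -> f = g.
Proof.
case: f g => f Pf [g Pg] /= /funext e; subst g.
by congr OmegaHom; exact: Prop_irrelevance.
Qed.

Lemma operad_map_id (T : tree) : operad_map (fun x : T => x).
Proof. by move=> s e; rewrite map_id. Qed.

Lemma operad_map_comp (T U V : tree) (g : U -> V) (f : T -> U) :
  operad_map g -> operad_map f -> operad_map (fun x => g (f x)).
Proof. by move=> Pg Pf s e /Pf /Pg; rewrite -map_comp. Qed.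

Definition Omega : category.
Proof.
refine (@Category tree omega_hom
  (fun T => OmegaHom (@operad_map_id T))
  (fun T U V g f => OmegaHom (operad_map_comp (omega_map g) (omega_map f)))
  _ _ _) => *; exact: omega_hom_eq.
Defined.

Definition closed (T : Omega) : Prop := leaves T = set0.

Definition Omegac : category := fullsub closed.

Definition dendroidal (k : nat) (T : Omegac) : Prop :=
  forall e : fsval T, valence e <= k.

Section Closure.

Lemma no_leaf_max (T : tree) (l x : T) : l \in set0 -> (l <= x)%O -> x = l.
Proof. by rewrite inE. Qed.

Definition close_tree (T : tree) : tree :=
  Tree (tree_root T) (@tree_chain T) (@no_leaf_max T).

Definition close (T : Omega) : Omegac :=
  @FsOb Omega closed (close_tree T) (erefl : closed (close_tree T)).

Lemma free_ge (T : tree) s (e x : T) : free_op s e -> x \in s -> (e <= x)%O.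
Proof.
move=> F; elim: F x => {s e} [e|e s Ne _ IH|s t e st _ IH] x.
- by rewrite inE => /eqP->.
- case/flatten_mapP => y; rewrite mem_enum => yu xs.
  apply: le_trans (IH _ yu _ xs); move: yu; rewrite inE => /andP[+ _].
  exact: ltW.
- by rewrite -(perm_mem st); exact: IH.
Qed.

Lemma up_inj (T : tree) (e x y z : T) :
  x \in up e -> y \in up e -> (x <= z)%O -> (y <= z)%O -> x = y.
Proof.
rewrite !inE => /andP[ex /forallP hx] /andP[ey /forallP hy] xz yz.
case/orP: (tree_chain xz yz) => h.
- by move/implyP: (hy x); rewrite ex h => /(_ isT)/eqP.
- by move/implyP: (hx y); rewrite ey h => /(_ isT)/eqP.
Qed.

Lemma free_uniq (T : tree) s (e : T) : free_op s e -> uniq s.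
Proof.
elim=> {s e} [e|e s _ F IH|s t e st _ IH] //; last by rewrite -(perm_uniq st).
have: {subset enum (up e) <= up e} by move=> x; rewrite mem_enum.
elim: (enum (up e)) (enum_uniq (up e)) => [|x r IHr] //= /andP[xr ur] sub.
rewrite cat_uniq IH ?sub ?mem_head //= IHr //; last first.
  by move=> y yr; apply: sub; rewrite inE yr orbT.
rewrite andbT; apply/hasPn => z /flatten_mapP[y yr zy]; apply/negP => zx.
have yu : y \in up e by apply: sub; rewrite inE yr orbT.
have xu : x \in up e by apply: sub; rewrite mem_head.
have xy := up_inj xu yu (free_ge (F _ xu) zx) (free_ge (F _ yu) zy).
by rewrite xy yr in xr.
Qed.

Lemma flatten_map_flatten (S R : Type) (t : S -> seq R) (ss : seq (seq S)) :
  flatten (map t (flatten ss)) = flatten [seq flatten (map t s) | s <- ss].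
Proof. by elim: ss => //= s ss IH; rewrite map_cat flatten_cat IH. Qed.

Lemma free_comp (T : tree) s (e : T) (t : T -> seq T) :
  free_op s e -> (forall x, x \in s -> free_op (t x) x) ->
  free_op (flatten (map t s)) e.
Proof.
move=> F; elim: F => {s e} [e|e s Ne F IH|s s' e ss' _ IH] H.
- by rewrite /= cats0; apply: H; rewrite inE.
- rewrite flatten_map_flatten -map_comp; apply: free_graft => // x xe.
  apply: IH => // y ys; apply: H; apply/flatten_mapP; exists x => //.
  by rewrite mem_enum.
- apply: (@free_perm _ (flatten (map t s))).
    exact/perm_flatten/perm_map.
  by apply: IH => x xs; apply: H; rewrite -(perm_mem ss').
Qed.

Lemma free_gen (T : tree) (e : T) :
  e \notin leaves T -> free_op (enum (up e)) e.
Proof.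
move=> Ne; rewrite -(flatten_seq1 (enum _)).
by apply: free_graft => // x _; exact: free_id.
Qed.

Lemma free_nil (T : tree) (e : T) : leaves T = set0 -> free_op [::] e.
Proof.
move=> cT; have [n] := ubnP #|[set x | (e < x)%O]|.
elim: n e => // n IH e; rewrite ltnS => le_n.
have -> : [::] = flatten [seq (fun=> [::] : seq T) x | x <- enum (up e)].
  by elim: (enum _).
apply: free_graft => [|x]; first by rewrite cT inE.
rewrite inE => /andP[ex _]; apply: IH; apply: leq_trans le_n.
apply: proper_card; apply/properP; split.
  by apply/subsetP => y; rewrite !inE; exact: lt_trans.
by exists x; rewrite !inE ?ltxx.
Qed.

Lemma up_leaf (T : tree) (e : T) : e \in leaves T -> up e = set0.
Proof.
move=> el; apply/setP => x; rewrite !inE; apply/negbTE/nandP; left.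
by apply/negP => ex; have := leaves_max el (ltW ex) => xe; rewrite xe ltxx in ex.
Qed.

Lemma operad_map_close (T U : tree) (f : T -> U) :
  leaves U = set0 -> operad_map f -> @operad_map (close_tree T) U f.
Proof.
move=> cU Pf s e; elim=> {s e} [e|e s _ _ IH|s t e st _ IH].
- exact: free_id.
- case: (boolP ((e : T) \in leaves T)) => [el|Ne].
    have -> : up (e : close_tree T) = set0 by exact: (@up_leaf T).
    by rewrite enum_set0; exact: free_nil.
  have := Pf _ _ (free_gen Ne) => Fe.
  have Uf := free_uniq Fe.
  have {}IH x : x \in up (e : T) -> free_op (map f (s x)) (f x) by exact: IH.
  change (free_op (map f (flatten [seq s x | x <- enum (up (e : T))])) (f e)).
  pose g (y : U) : T := nth e (enum (up (e : T))) (index y (map f (enum (up (e : T))))).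
  have gK x : x \in up (e : T) -> g (f x) = x.
    rewrite -mem_enum => xe; rewrite /g.
    have -> : index (f x) (map f (enum (up (e : T)))) = index x (enum (up (e : T))).
      have := index_uniq (f e) (_ : index x (enum (up (e : T))) < size (map f (enum (up (e : T))))) Uf.
      by rewrite size_map index_mem => /(_ xe); rewrite (nth_map e) ?index_mem // nth_index.
    exact: nth_index.
  have := @free_comp U _ _ (fun y => map f (s (g y))) Fe.
  rewrite -map_comp map_flatten -map_comp.
  have -> : [seq ((fun y => map f (s (g y))) \o f) x | x <- enum (up (e : T))] =
            [seq (map f \o s) x | x <- enum (up (e : T))].
    by apply/eq_in_map => x; rewrite mem_enum => xe /=; rewrite gK.
  apply=> y /mapP[x]; rewrite mem_enum => xe ->; rewrite gK //; exact: IH.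
- by apply: (free_perm _ IH); exact: perm_map.
Qed.

End Closure.

(* The adjunct T^c -> U of a map f : T -> U into a closed tree. *)
Definition adj (T : Omega) (U : Omegac) (f : hom T (fsval U)) :
    hom (close T) U :=
  OmegaHom (operad_map_close (fsP U) (omega_map f)).

Lemma operad_map_unit (T : tree) :
  @operad_map T (close_tree T) (fun x => x).
Proof.
move=> s e; rewrite map_id; elim=> {s e} [e|e s _ _ IH|s t e st _ IH].
- exact: (@free_id (close_tree T)).
- by apply: (@free_graft (close_tree T)); rewrite ?inE.
- exact: (@free_perm (close_tree T) s).
Qed.

Definition close_unit (T : Omega) : hom T (fsval (close T)) :=
  OmegaHom (@operad_map_unit T).

Definition close_map (T U : Omega) (f : hom T U) : hom (close T) (close U) :=
  adj (mcomp (close_unit U) f).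

Section LinearTree.
Variable n : nat.

Lemma linear_root : exists r : 'I_n.+1, forall x, (r <= x)%O.
Proof. by exists ord0 => x; rewrite leEord. Qed.

Lemma linear_chain (x y z : 'I_n.+1) : (y <= x)%O -> (z <= x)%O -> (y >=< z)%O.
Proof. by move=> _ _; exact: comparableT. Qed.

Lemma linear_leaves (l x : 'I_n.+1) :
  l \in [set ord_max] -> (l <= x)%O -> x = l.
Proof.
rewrite inE leEord => /eqP-> h; apply/val_inj/eqP.
by rewrite eqn_leq h -ltnS ltn_ord.
Qed.

Definition linear : tree := Tree linear_root linear_chain linear_leaves.

End LinearTree.

Definition eta : tree := linear 0.

Definition star (n : nat) : Type := 'I_n.+1.
HB.instance Definition _ n := Finite.on (star n).

Section Corolla.
Variable n : nat.

Definition star_le (x y : star n) : bool := (x == y) || (x == ord0 :> 'I_n.+1).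

Lemma star_le_refl : reflexive star_le.
Proof. by move=> x; rewrite /star_le eqxx. Qed.

Lemma star_le_anti : antisymmetric star_le.
Proof.
move=> x y /andP[/orP[/eqP//|/eqP x0] /orP[/eqP//|/eqP y0]].
by rewrite x0 y0.
Qed.

Lemma star_le_trans : transitive star_le.
Proof.
move=> y x z /orP[/eqP->//|/eqP->] _.
by rewrite /star_le eqxx orbT.
Qed.

Fact star_display : Order.disp_t. Proof. exact: Order.Disp tt tt. Qed.

HB.instance Definition _ := @Order.Le_isPOrder.Build star_display (star n)
  star_le star_le_refl star_le_anti star_le_trans.

Lemma corolla_root : exists r : star n, forall x, (r <= x)%O.
Proof. by exists ord0 => x; apply/orP; right. Qed.

Lemma corolla_chain (x y z : star n) : (y <= x)%O -> (z <= x)%O -> (y >=< z)%O.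
Proof.
case/orP=> /eqP->; case/orP=> /eqP->; rewrite /Order.comparable.
- by rewrite lexx.
- by apply/orP; right; apply/orP; right.
- by apply/orP; left; apply/orP; right.
- by rewrite lexx.
Qed.

Lemma corolla_leaves (l x : star n) :
  l \in [set y : star n | y != ord0 :> 'I_n.+1] -> (l <= x)%O -> x = l.
Proof. by rewrite inE => /negbTE l0 /orP[/eqP->|]; rewrite ?l0. Qed.

Definition corolla : tree := Tree corolla_root corolla_chain corolla_leaves.

End Corolla.

Inductive elementary := Eta | Corolla (n : nat).

Definition el_tree (X : elementary) : Omega :=
  match X with Eta => eta | Corolla n => corolla n end.

Definition subtree_inclusion (T U : tree) (f : T -> U) : Prop :=
  injective f /\
  forall (e0 e2 : T) (e' : U), (f e0 <= e')%O -> (e' <= f e2)%O ->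
    exists e1, f e1 = e'.

Definition full_valence (T : Omega) (X : elementary) :
    hom (el_tree X) T -> Prop :=
  match X with
  | Eta => fun=> True
  | Corolla n => fun f : omega_hom (corolla n) T => valence (f (ord0 : star n)) = n
  end.

Record el_ob (T : Omega) := ElOb {
  el_shape : elementary;
  el_map : hom (el_tree el_shape) T;
  el_subtree : subtree_inclusion (el_map : omega_hom _ _);
  el_valence : full_valence el_map }.

Definition El (T : Omega) : category :=
  @fullfam (slice T) (el_ob T) (fun x => SliceOb (el_map x)).

Definition el_diagram (F : psh Omegac) (T : Omega) : diagram (op (El T)).
Proof.
refine (@Diagram (op (El T)) (fun x => F (close (el_tree (el_shape x))))
  (fun x y f => @dmap (op Omegac) F _ _ (close_map (over_map f))) _ _).
- move=> x n a; rewrite -[RHS](@dmap_id (op Omegac) F).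
  by congr (@dmap (op Omegac) F _ _ _ n a); exact: omega_hom_eq.
- move=> x y z g f n a; rewrite -(@dmap_comp (op Omegac) F).
  by congr (@dmap (op Omegac) F _ _ _ n a); exact: omega_hom_eq.
Defined.

Lemma segal_cone (F : psh Omegac) (T : Omegac) (x y : op (El (fsval T)))
    (f : hom x y) n (a : F T n) :
  @dmap (op Omegac) F _ _ (adj (el_map y)) n a =
  dmap (el_diagram F (fsval T)) f n
    (@dmap (op Omegac) F _ _ (adj (el_map x)) n a).
Proof.
rewrite -(@dmap_comp (op Omegac) F).
congr (@dmap (op Omegac) F _ _ _ n a); apply: omega_hom_eq => e /=.
exact: (congr1 (fun h : @hom Omega (el_tree (el_shape y)) (fsval T) =>
  omega_fun h e) (esym (over_comm f))).
Qed.

Definition segal_map (F : psh Omegac) (T : Omegac) :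
    smap (F T) (holim (el_diagram F (fsval T))) :=
  @to_holim (op (El (fsval T))) (el_diagram F (fsval T)) (F T)
    (fun x => @dmap (op Omegac) F _ _ (adj (el_map x))) (@segal_cone F T).

Definition segal (F : psh Omegac) : Prop :=
  forall T : Omegac, hequiv (segal_map F T).

Record inert_ob (n : nat) := InertOb {
  inert_src : nat;
  inert_map : delta_hom inert_src n;
  inert_src_le1 : inert_src <= 1;
  inertP : forall a, inert_map a = inert_map ord0 + a :> nat }.

(* The inert maps [0] -> [n] and [1] -> [n], over [n]. *)
Definition Inert (n : nat) : category :=
  @fullfam (@slice Delta n) (inert_ob n)
    (fun x => @SliceOb Delta n (inert_src x) (inert_map x)).

Definition inert_diagram (X : diagram (op Delta)) (n : nat) :
    diagram (op (Inert n)).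
Proof.
refine (@Diagram (op (Inert n)) (fun x => X (inert_src x))
  (fun x y f => @dmap (op Delta) X _ _ (over_map f)) _ _).
- by move=> x m a; exact: (@dmap_id (op Delta) X).
- by move=> x y z g f m a; exact: (@dmap_comp (op Delta) X).
Defined.

Lemma inert_cone (X : diagram (op Delta)) (n : nat) (x y : op (Inert n))
    (f : hom x y) m (a : X n m) :
  @dmap (op Delta) X _ _ (inert_map y) m a =
  dmap (inert_diagram X n) f m (@dmap (op Delta) X _ _ (inert_map x) m a).
Proof.
rewrite /= -(@dmap_comp (op Delta) X).
by congr (@dmap (op Delta) X _ _ _ m a); exact: esym (over_comm f).
Qed.

(* X_n -> X_1 x_{X_0} ... x_{X_0} X_1, with homotopy pullbacks. *)
Definition spine_map (X : diagram (op Delta)) (n : nat) :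
    smap (X n) (holim (inert_diagram X n)) :=
  @to_holim (op (Inert n)) (inert_diagram X n) (X n)
    (fun x => @dmap (op Delta) X _ _ (inert_map x)) (@inert_cone X n).

Definition segal_space (X : diagram (op Delta)) : Prop :=
  forall n, hequiv (spine_map X n).

Section Completeness.
Variable X : diagram (op Delta).

Definition face m n (f : delta_hom m n) : smap (X n) (X m) :=
  @dmap (op Delta) X n m f.

Definition joined (Y : sset) (x y : Y 0) : Prop :=
  exists e : Y 1, sact (coface ord_max) e = x /\ sact (coface ord0) e = y.

Definition src (f : X 1 0) : X 0 0 := face (coface ord_max) 0 f.
Definition tgt (f : X 1 0) : X 0 0 := face (coface ord0) 0 f.
Definition ident (x : X 0 0) : X 1 0 := face (@cst_map 1 0 ord0) 0 x.

Definition composite (f g h : X 1 0) : Prop :=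
  exists s : X 2 0,
  [/\ joined (face (coface ord_max) 0 s) f, joined (face (coface ord0) 0 s) g
    & joined (face (coface (inord 1)) 0 s) h].

(* f has a left and a right homotopy inverse.  Edges are only compared up to
   paths in X_1: in a Segal space being a homotopy equivalence depends only on
   the path component, so this is Rezk's condition without requiring X to be
   Reedy fibrant. *)
Definition homotopy_equivalence (f : X 1 0) : Prop :=
  (exists g, composite f g (ident (src f))) /\
  (exists g, composite g f (ident (tgt f))).

(* X_hoequiv: the path components of X_1 of homotopy equivalences. *)
Definition hoequiv_simp n : Type :=
  {x : X 1 n | forall i, homotopy_equivalence (sact (@cst_map 0 n i) x)}.

Lemma hoequiv_act_subproof m n (f : delta_hom m n) (x : hoequiv_simp n) i :
  homotopy_equivalence (sact (@cst_map 0 m i) (sact f (sval x))).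
Proof.
rewrite -(sact_comp f (@cst_map 0 m i)).
by rewrite delta_comp_cst; exact: (proj2_sig x (f i)).
Qed.

Definition hoequiv : sset.
Proof.
refine (@SSet hoequiv_simp
  (fun m n f x => exist _ (sact f (sval x)) (hoequiv_act_subproof f x)) _ _).
- by move=> n [x Px]; apply: eq_exist; exact: sact_id.
- by move=> m n p g f [x Px]; apply: eq_exist; exact: sact_comp.
Defined.

Lemma joined_refl (Y : sset) (y : Y 0) : joined y y.
Proof.
by exists (sact (@cst_map 1 0 ord0) y); split;
  rewrite -(sact_comp (@cst_map 1 0 ord0)) -[RHS](sact_id y);
  congr (sact _ y); apply: delta_hom_eq => a; rewrite !ord1.
Qed.

Lemma face_cst m n (f : delta_hom m n) k (x : X 0 k) :
  face f k (face (@cst_map n 0 ord0) k x) = face (@cst_map m 0 ord0) k x.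
Proof. by rewrite /face -(@dmap_comp (op Delta) X) /= cst_comp_delta. Qed.

Lemma ident_equiv (x : X 0 0) : homotopy_equivalence (ident x).
Proof.
have srcE : src (ident x) = x.
  rewrite /src /ident face_cst -[RHS](@dmap_id (op Delta) X).
  by congr (@dmap (op Delta) X _ _ _ _ x); apply: delta_hom_eq => a; rewrite !ord1.
have tgtE : tgt (ident x) = x.
  rewrite /tgt /ident face_cst -[RHS](@dmap_id (op Delta) X).
  by congr (@dmap (op Delta) X _ _ _ _ x); apply: delta_hom_eq => a; rewrite !ord1.
have cE : composite (ident x) (ident x) (ident x).
  exists (face (@cst_map 2 0 ord0) 0 x).
  by rewrite !face_cst; split; exact: joined_refl.
by split; exists (ident x); rewrite ?srcE ?tgtE.
Qed.

Lemma degen_subproof n (x : X 0 n) i :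
  homotopy_equivalence
    (sact (@cst_map 0 n i) (face (@cst_map 1 0 ord0) n x)).
Proof. by rewrite -smap_nat; exact: ident_equiv. Qed.

Definition degen : smap (X 0) hoequiv.
Proof.
refine (@SMap (X 0) hoequiv (fun n x => exist _ _ (degen_subproof x)) _).
by move=> m n f x; apply: eq_exist; exact: smap_nat.
Defined.

End Completeness.

Definition complete_segal_space (X : diagram (op Delta)) : Prop :=
  segal_space X /\ hequiv (degen X).

Lemma linear_leE n (x y : linear n) : (x <= y)%O = (x <= y)%N.
Proof. by []. Qed.

Lemma linear_ltE n (x y : linear n) : (x < y)%O = (x < y)%N.
Proof. by []. Qed.

Lemma linear_up n (e : linear n) :
  e \notin leaves (linear n) -> exists2 x, up e = [set x] & x = e.+1 :> nat.
Proof.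
rewrite inE => Ne; have lt_e : e.+1 < n.+1.
  rewrite ltn_neqAle ltn_ord andbT; apply: contraNneq Ne => -[en].
  exact/eqP/val_inj.
exists (Ordinal lt_e) => //; apply/setP => x; rewrite !inE linear_ltE.
apply/andP/eqP => [[ex /forallP/(_ (Ordinal lt_e))]|->].
  by rewrite linear_ltE linear_leE /= ltnSn ex /= => /eqP.
split=> /=; first exact: ltnSn.
apply/forallP => y; rewrite linear_ltE linear_leE /=; apply/implyP => /andP[h1 h2].
by apply/eqP/val_inj/eqP; rewrite /= eqn_leq h1 h2.
Qed.

Lemma linear_free n s (e : linear n) :
  free_op s e -> exists2 x : linear n, s = [:: x] & e <= x.
Proof.
elim=> {s e} [e|e s Ne _ IH|s t e st _ [x sx ex]].
- by exists e.
- have [x ux xE] := linear_up Ne.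
  have [|y sy xy] := IH x; first by rewrite ux inE.
  exists y; first by rewrite ux enum_set1 /= sy.
  by apply: leq_trans xy; rewrite xE.
- by exists x => //; apply: perm_small_eq => //; rewrite perm_sym -sx.
Qed.

Lemma linear_freeP n (e x : linear n) : e <= x -> free_op [:: x] e.
Proof.
have [k] := ubnP (x - e); elim: k e => // k IH e; rewrite ltnS => le_k ex.
move: (ex); rewrite leq_eqVlt => /orP[/eqP/val_inj<-|lt_ex].
  exact: free_id.
have Ne : e \notin leaves (linear n).
  rewrite inE; apply: contraTneq lt_ex => ->.
  by rewrite -leqNgt -ltnS ltn_ord.
have [y uy yE] := linear_up Ne.
have -> : [:: x] = flatten [seq (fun=> [:: x]) z | z <- enum (up e)].
  by rewrite uy enum_set1.
apply: free_graft => // z; rewrite uy inE => /eqP->.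
by apply: IH; rewrite yE // subnS; case: (x - e) le_k (subn_gt0 e x) => //; rewrite lt_ex.
Qed.

Lemma linear_operad_map m n (f : delta_hom m n) :
  @operad_map (linear m) (linear n) f.
Proof.
by move=> s e /linear_free[x -> ex]; apply: linear_freeP; exact: delta_mono.
Qed.

Definition linear_map m n (f : delta_hom m n) :
    @hom Omega (linear m) (linear n) :=
  OmegaHom (linear_operad_map f).

Definition rDelta : functor Delta Omegac.
Proof.
refine (@Functor Delta Omegac (fun n => close (linear n))
  (fun m n f => close_map (linear_map f)) _ _).
- by move=> n; exact: omega_hom_eq.
- by move=> m n p g f; exact: omega_hom_eq.
Defined.

Definition complete (F : psh Omegac) : Prop :=
  complete_segal_space (dpull (fop rDelta) F).

Record unital_operad := UnitalOperad {
  op_psh :> psh Omegac;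
  op_kan : forall T : Omegac, kan (op_psh T);
  op_segal : segal op_psh;
  op_complete : complete op_psh }.

(* R_k (O^k) *)
Definition R (k : nat) (O : psh Omegac) : psh Omegac := ran_sub O (dendroidal k).

Lemma dendroidal_le k l (kl : k <= l) T : dendroidal k T -> dendroidal l T.
Proof. by move=> kT e; exact: leq_trans kl. Qed.

Definition leq_cat : category :=
  @Category nat (fun m n => m <= n) leqnn (fun m n p np mn => leq_trans mn np)
    (fun m n f => bool_irrelevance _ _) (fun m n f => bool_irrelevance _ _)
    (fun m n p q h g f => bool_irrelevance _ _).

Definition Npos : category := @fullsub leq_cat (fun k => 0 < k).

Lemma ran_restrict_id (C : category) (F : psh C) (P : C -> Prop)
    (PP : forall x, P x -> P x) c n (x : ran_sub F P c n) :
  ran_restrict PP F c n x = x.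
Proof.
have -> : PP = fun x Px => Px by exact: Prop_irrelevance.
by apply: whlim_eq => y p b t /=; congr (sval x y p _ t); case: b => *; exact: Bar_eq.
Qed.

Lemma ran_restrict_comp (C : category) (F : psh C) (P Q Q' : C -> Prop)
    (PQ : forall x, P x -> Q x) (QQ' : forall x, Q x -> Q' x)
    (PQ' : forall x, P x -> Q' x) c n (x : ran_sub F Q' c n) :
  ran_restrict PQ' F c n x = ran_restrict PQ F c n (ran_restrict QQ' F c n x).
Proof.
have -> : PQ' = fun x Px => QQ' x (PQ x Px) by exact: Prop_irrelevance.
apply: whlim_eq => y p b t /=.
by congr (sval x (FsOb (QQ' _ (PQ _ (fsP y)))) p _ t); apply: Bar_eq.
Qed.

Definition tower (O : psh Omegac) : psh_diagram (op Npos) Omegac.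
Proof.
refine (@PshDiagram (op Npos) Omegac (fun k => R (fsval k) O)
  (fun k l lk => ran_restrict (dendroidal_le lk) O) _ _).
- by move=> k c n x; exact: ran_restrict_id.
- by move=> k l m g f c n x; exact: ran_restrict_comp.
Defined.

Definition tower_unit (O : psh Omegac) (k : nat) : dmor O (R k O) :=
  ran_unit (incl (dendroidal k)) O.

Lemma tower_unit_cone (O : psh Omegac) (k l : op Npos) (lk : hom k l)
    (T : Omegac) n (x : O T n) :
  tower_unit O (fsval l) T n x =
  pdmap (tower O) lk T n (tower_unit O (fsval k) T n x).
Proof.
by apply: (@whlim_eq _ (hom_weight (incl (dendroidal (fsval l))) T)).
Qed.

Definition to_tower_limit (O : psh Omegac) : dmor O (psh_holim (tower O)) :=
  @to_psh_holim (op Npos) Omegac (tower O) O (fun k => tower_unit O (fsval k))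
    (@tower_unit_cone O).

(* Main.v *)
(* At a closed tree T of maximal valence K, the tower is constant with value O(T)
   from k = K on: for T k-dendroidal, (R_k O)(T) is a homotopy limit over an
   index category in which (T, id) is initial.  Evaluation at (K, T) is therefore
   an inverse of the map, strictly on one side and up to explicit homotopies on
   the other. *)
From mathcomp Require Import all_boot all_order.
From mathcomp Require Import boolp.
From Stdlib Require Import Relation_Operators.
Require Import Defs.
Set Implicit Arguments.
Unset Strict Implicit.
Unset Printing Implicit Defensive.

(** * Equality of simplicial maps and of bar simplices *)

Lemma smap_eq (X Y : sset) (f g : smap X Y) :
  (forall n x, f n x = g n x) -> f = g.
Proof.
case: f g => f Pf [g Pg] /= e.
have ? : f = g by do 2 apply: functional_extensionality_dep => ?.
by subst g; congr SMap; exact: Prop_irrelevance.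
Qed.

Lemma Bar_mor_eq (J : category) (H : weight J) (j : J) p (s : 'I_p.+1 -> J)
    (mor mor' : forall a b : 'I_p.+1, a <= b -> hom (s a) (s b))
    (elt elt' : forall a, H (s a)) (cone cone' : forall a, hom (s a) j)
    m1 m2 e1 c1 m1' m2' e1' c1' :
  (forall (a b : 'I_p.+1) (h : a <= b), mor a b h = mor' a b h) ->
  (forall a, elt a = elt' a) -> (forall a, cone a = cone' a) ->
  @Bar J H j p s mor elt cone m1 m2 e1 c1 =
  @Bar J H j p s mor' elt' cone' m1' m2' e1' c1'.
Proof.
move=> em eu ec.
have ? : mor = mor' by do 3 apply: functional_extensionality_dep => ?.
by subst mor'; exact: Bar_eq.
Qed.

Definition hom_cast (C : category) (x x' y y' : C) (ex : x = x') (ey : y = y')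
    (f : hom x y) : hom x' y' :=
  eq_rect y (hom x') (eq_rect x (fun z => hom z y) f x' ex) y' ey.

(** For chains whose vertices agree only propositionally: once extensionality identifies the vertex
    functions, proof irrelevance makes [e] reflexivity and the casts vanish. *)
Lemma Bar_heq (J : category) (H : weight J) (j : J) p (b b' : bar H j p)
    (e : forall a, bob b a = bob b' a) :
  (forall (a a' : 'I_p.+1) (h : a <= a'),
    hom_cast (e a) (e a') (bmor b h) = bmor b' h) ->
  (forall a, eq_rect _ H (belt b a) _ (e a) = belt b' a) ->
  (forall a, hom_cast (e a) erefl (bcone b a) = bcone b' a) ->
  b = b'.
Proof.
case: b b' e => s m u c m1 m2 e1 c1 [s' m' u' c' m1' m2' e1' c1'] /= e.
have es : s = s' by exact: functional_extensionality_dep.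
subst s'; have -> : e = fun=> erefl by exact: Prop_irrelevance.
exact: Bar_mor_eq.
Qed.

(** The degenerate simplex on the terminal object of the slice el(H)/(j,h). *)
Definition const_bar (J : category) (H : weight J) (j : J) (h : H j) p :
  bar H j p.
Proof.
refine (@Bar J H j p (fun=> j) (fun _ _ _ => idm j) (fun=> h) (fun=> idm j)
  _ _ _ _) => *; rewrite ?comp1m ?wmap_id //.
Defined.

(** * Homotopies from transformations of bar simplices *)

(** A natural transformation between two chains, regarded as functors from [p] to the category of
    elements of [H] over [j]. *)
Record bar_trans (J : category) (H : weight J) (j : J) p (b0 b1 : bar H j p) :=
  BarTrans {
  btr :> forall a, hom (bob b0 a) (bob b1 a);
  btr_mor : forall (a a' : 'I_p.+1) (h : a <= a'),
    mcomp (btr a') (bmor b0 h) = mcomp (bmor b1 h) (btr a);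
  btr_elt : forall a, wmap (btr a) (belt b0 a) = belt b1 a;
  btr_cone : forall a, mcomp (bcone b1 a) (btr a) = bcone b0 a }.

Section Mix.
Variables (J : category) (H : weight J) (j : J) (p : nat).

(** The arrows of a mixed chain: [true] marks a vertex of the first chain, [d] crosses to the second
    one, and the implication excludes crossing back. *)
Definition if_hom (x y : bool) (i0 i1 j0 j1 : J) (f0 : hom i0 j0)
    (f1 : hom i1 j1) (d : hom i0 j1) :
    y ==> x -> hom (if x then i0 else i1) (if y then j0 else j1) :=
  match x, y return
    y ==> x -> hom (if x then i0 else i1) (if y then j0 else j1) with
  | true, true => fun=> f0
  | true, false => fun=> d
  | false, false => fun=> f1
  | false, true => fun h => False_rect _ (notF h)
  end.

Lemma if_hom_eq x y i0 i1 j0 j1 (f0 f0' : hom i0 j0) (f1 f1' : hom i1 j1)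
    (d d' : hom i0 j1) (l l' : y ==> x) :
  f0 = f0' -> f1 = f1' -> d = d' -> if_hom f0 f1 d l = if_hom f0' f1' d' l'.
Proof. by move=> -> -> ->; congr if_hom; exact: bool_irrelevance. Qed.

Lemma mix_le (r : delta_hom p 1) (a a' : 'I_p.+1) :
  a <= a' -> (r a' == ord0) ==> (r a == ord0).
Proof.
move=> h; apply/implyP => /eqP r0; apply/eqP/val_inj/eqP.
by rewrite -leqn0; have := delta_mono r h; rewrite r0.
Qed.

(* The vertices of b0 where r = 0, followed by those of b1 where r = 1: reading
   it as a function of r : [p] -> [1] turns a natural family of bar_trans into a
   homotopy. *)
Definition mix (b0 b1 : bar H j p) (u : bar_trans b0 b1) (r : delta_hom p 1) :
  bar H j p.
Proof.
refine (@Bar J H j p (fun a => if r a == ord0 then bob b0 a else bob b1 a)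
  (fun a a' h => if_hom (bmor b0 h) (bmor b1 h) (mcomp (bmor b1 h) (u a))
     (mix_le r h))
  (fun a => if r a == ord0 as x return H (if x then bob b0 a else bob b1 a)
     then belt b0 a else belt b1 a)
  (fun a => if r a == ord0 as x return hom (if x then bob b0 a else bob b1 a) j
     then bcone b0 a else bcone b1 a) _ _ _ _).
- move=> a h; move: (mix_le r h); case: (r a == ord0) => i /=; exact: bmor_id.
- move=> a a' a'' h h' h''.
  move: (mix_le r h) (mix_le r h') (mix_le r h'').
  case: (r a == ord0); case: (r a' == ord0); case: (r a'' == ord0) => //= _ _ _.
  + exact: bmor_comp.
  (* The crossing lies between [a'] and [a'']; naturality of [u] moves it back to [a]. *)
  + by rewrite -compA btr_mor compA -bmor_comp.
  + by rewrite compA -bmor_comp.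
  + exact: bmor_comp.
- move=> a a' h; move: (mix_le r h).
  case: (r a == ord0); case: (r a' == ord0) => //= _; try exact: belt_nat.
  by rewrite wmap_comp btr_elt belt_nat.
- move=> a a' h; move: (mix_le r h).
  case: (r a == ord0); case: (r a' == ord0) => //= _; try exact: bcone_nat.
  by rewrite compA bcone_nat btr_cone.
Defined.

Lemma mix0 (b0 b1 : bar H j p) (u : bar_trans b0 b1) :
  mix u (cst_map p ord0) = b0.
Proof. by case: b0 u => *; exact: Bar_eq. Qed.

Lemma mix1 (b0 b1 : bar H j p) (u : bar_trans b0 b1) :
  mix u (cst_map p ord_max) = b1.
Proof. by case: b1 u => *; exact: Bar_eq. Qed.

End Mix.

Section HomotopyEnds.
Variables (X Y : sset) (H : forall n, X n -> delta_hom n 1 -> Y n).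
Hypothesis HE : forall m n (s : delta_hom m n) (x : X n) (r : delta_hom n 1),
  H (sact s x) (delta_comp r s) = sact s (H x r).

Lemma homotopy_end_nat (i : 'I_2) m n (s : delta_hom m n) (x : X n) :
  H (sact s x) (cst_map m i) = sact s (H x (cst_map n i)).
Proof. by rewrite -HE cst_comp_delta. Qed.

Definition homotopy_end (i : 'I_2) : smap X Y :=
  @SMap X Y (fun n x => H x (cst_map n i)) (@homotopy_end_nat i).

Lemma homotopy_ends : homotopic (homotopy_end ord0) (homotopy_end ord_max).
Proof. by apply: rst_step; exists H. Qed.

End HomotopyEnds.

(* The indexing category el(H) has the initial object (i0, e0), so holim over it
   is evaluation there. *)
Section Initial.
Variables (J : category) (H : weight J) (D : diagram J) (i0 : J) (e0 : H i0).
Variable ini : forall j, H j -> hom i0 j.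
Hypothesis ini_elt : forall j (h : H j), wmap (ini h) e0 = h.
Hypothesis ini_nat : forall i j (f : hom i j) (h : H i),
  mcomp f (ini h) = ini (wmap f h).

(** The components are the arrows out of the initial object; [ini_nat] makes them natural and
    compatible with the cones. *)
Lemma ini_trans j p (b : bar H j p) :
  bar_trans (bar_push (ini (bar_aug b)) (const_bar e0 p)) b.
Proof.
exists (fun a => ini (belt b a)) => [a a' h|a|a] /=.
- by rewrite compm1 ini_nat belt_nat.
- exact: ini_elt.
- by rewrite ini_nat bar_augE compm1.
Defined.

(** The cut of the chain is read off from [r] after [t], so faces act compatibly. The cone of the
    constant part depends only on [bar_aug b], which faces preserve and [bar_push] transports. *)
Lemma contraction_natural n (x : whlim H D n) (r : delta_hom n 1) :
  @whlim_natural J H D n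
    (fun j p b t => sval x j p (mix (ini_trans b) (delta_comp r t)) t).
Proof.
case: x => phi [nat1 nat2]; split=> /= [j p q s b t|j j' f p b t].
- rewrite -nat1; congr (phi _ _ _ _).
  apply: Bar_mor_eq => /= [a a' l|a|a]; first exact: if_hom_eq.
  - by case: (_ == ord0).
  (* The first vertex of the face is the vertex [s ord0] of [b]; [bar_augE] computes the
     augmentation of [b] there. *)
  - by case: (_ == ord0) => //=; rewrite !compm1 -(bar_augE b (s ord0)).
- apply: (etrans _ (nat2 _ _ f _ _ _)); congr (phi _ _ _ _).
  apply: Bar_mor_eq => /= [a a' l|a|a]; first exact: if_hom_eq.
  - by case: (_ == ord0).
  - by case: (_ == ord0) => //=; rewrite !compm1 ini_nat /bar_aug /= wmap_comp.
Qed.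

Definition contraction n (x : whlim H D n) (r : delta_hom n 1) : whlim H D n :=
  exist _ _ (contraction_natural x r).

Lemma contraction_sact m n (s : delta_hom m n) (x : whlim H D n) r :
  contraction (sact s x) (delta_comp r s) = sact s (contraction x r).
Proof. exact: whlim_eq. Qed.

Lemma contraction1 n (x : whlim H D n) : contraction x (cst_map n ord_max) = x.
Proof. by apply: whlim_eq => j p b t /=; rewrite cst_comp_delta mix1. Qed.

(** At the end 0 the chain is pushed forward from a constant one at [i0]. Naturality in [j] extracts
    the arrow; naturality in [p], with [t] the restriction of [delta_id n] along itself, leaves the
    value at a single simplex. *)
Lemma contraction0 n (x : whlim H D n) j p (b : bar H j p) t :
  sval (contraction x (cst_map n ord0)) j p b t =
  dmap D (ini (bar_aug b)) p (sact t (sval x i0 n (const_bar e0 n) (delta_id n))).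
Proof.
case: x => phi [nat1 nat2]; rewrite /= cst_comp_delta mix0.
by rewrite nat2 -nat1; congr (dmap D _ _ (phi _ _ _ _)).
Qed.

End Initial.

(** * Evaluation, and homotopy limits contracted through a zigzag *)

Definition weval (J : category) (H : weight J) (D : diagram J) (j : J) (h : H j) :
  smap (whlim H D) (D j).
Proof.
refine (@SMap (whlim H D) (D j)
  (fun n x => sval x j n (const_bar h n) (delta_id n)) _).
move=> m n f [phi [nat1 nat2]] /=.
by rewrite -nat1; congr (phi _ _ _ _); exact: Bar_eq.
Defined.

(* The index category is contracted to k through natural maps j <- c j -> k, and
   h contracts the values D (c j) to X.  Moving from id to c, contracting the
   values, and moving from c to k give three consecutive homotopies. *)
Section Zigzag.
Variables (J : category) (D : diagram J) (X : sset).
Variable f : forall j, smap X (D j).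
Hypothesis fE : forall i j (u : hom i j) n (x : X n),
  f j n x = dmap D u n (f i n x).

Variables (k : J) (e : smap (D k) X).
Hypothesis eK : forall n x, e n (f k n x) = x.

Variables (c : functor J J).
Variables (eps : forall j, hom (c j) j) (kap : forall j, hom (c j) k).
Hypothesis eps_nat : forall i j (u : hom i j),
  mcomp (eps j) (fmap c u) = mcomp u (eps i).
Hypothesis kap_nat : forall i j (u : hom i j), mcomp (kap j) (fmap c u) = kap i.

Variable h : forall j n, D (c j) n -> delta_hom n 1 -> D (c j) n.
Hypothesis h_sact : forall j m n (s : delta_hom m n) x r,
  @h j m (sact s x) (delta_comp r s) = sact s (h x r).
Hypothesis h_nat : forall i j (u : hom i j) n (x : D (c i) n) r,
  h (dmap D (fmap c u) n x) r = dmap D (fmap c u) n (h x r).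
Hypothesis h1 : forall j n (x : D (c j) n), h x (cst_map n ord_max) = x.
Hypothesis h0 : forall j n (x : D (c j) n),
  h x (cst_map n ord0) = f (c j) n (e n (dmap D (kap j) n x)).

Definition c_bar j p (b : bar (wone J) j p) : bar (wone J) (c j) p :=
  @bar_map J J c (wone J) (wone J)
    (@WMor J (wone J) (wpull c (wone J)) (fun _ y => y) (fun _ _ _ _ => erefl))
    j p b.

Lemma c_bar_act j p q (s : delta_hom q p) (b : bar (wone J) j p) :
  c_bar (bar_act s b) = bar_act s (c_bar b).
Proof. exact: Bar_eq. Qed.

Lemma c_bar_push i j (u : hom i j) p (b : bar (wone J) i p) :
  c_bar (bar_push u b) = bar_push (fmap c u) (c_bar b).
Proof. by apply: Bar_eq => //= a; rewrite fmap_comp. Qed.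

Definition eps_trans j p (b : bar (wone J) j p) :
  bar_trans (bar_push (eps j) (c_bar b)) b.
Proof.
exists (fun a => eps (bob b a)) => [a a' l|a|a] //=; exact: eps_nat.
Defined.

Definition kap_trans j p (b : bar (wone J) j p) :
  bar_trans (bar_push (kap j) (c_bar b)) (@const_bar J (wone J) k tt p).
Proof.
exists (fun a => kap (bob b a)) => [a a' l|a|a] /=.
- by rewrite comp1m kap_nat.
- by case: (belt b a).
- by rewrite comp1m kap_nat.
Defined.

Definition to_lim : smap X (holim D) := to_holim fE.

Definition from_lim : smap (holim D) X := scomp e (@weval J (wone J) D k tt).

Lemma eps_natural n (x : holim D n) (r : delta_hom n 1) :
  @whlim_natural J (wone J) D n
    (fun j p b t => sval x j p (mix (eps_trans b) (delta_comp r t)) t).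
Proof.
case: x => phi [nat1 nat2]; split=> /= [j p q s b t|i j u p b t].
- rewrite -nat1; congr (phi _ _ _ _).
  apply: Bar_mor_eq => /= [a a' l|a|a] //; exact: if_hom_eq.
- apply: (etrans _ (nat2 _ _ u _ _ _)); congr (phi _ _ _ _).
  apply: Bar_mor_eq => /= [a a' l|a|a]; first exact: if_hom_eq.
  - by case: (_ == ord0).
  - by case: (_ == ord0) => //=; rewrite fmap_comp !compA eps_nat.
Qed.

(** The values are contracted in D(c j), where [h] lives, and returned to D(j) along [eps]. *)
Lemma h_natural n (x : holim D n) (r : delta_hom n 1) :
  @whlim_natural J (wone J) D n
    (fun j p b t =>
       dmap D (eps j) p (h (sval x (c j) p (c_bar b) t) (delta_comp r t))).
Proof.
case: x => phi [nat1 nat2]; split=> /= [j p q s b t|i j u p b t].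
- by rewrite c_bar_act nat1 -smap_nat -h_sact.
- by rewrite c_bar_push nat2 h_nat -!dmap_comp eps_nat.
Qed.

Lemma kap_natural n (x : holim D n) (r : delta_hom n 1) :
  @whlim_natural J (wone J) D n
    (fun j p b t =>
       f j p (e p (sval x k p (mix (kap_trans b) (delta_comp r t)) t))).
Proof.
case: x => phi [nat1 nat2]; split=> /= [j p q s b t|i j u p b t].
- rewrite -!smap_nat -nat1; congr (f _ _ (e _ (phi _ _ _ _))).
  apply: Bar_mor_eq => /= [a a' l|a|a] //; exact: if_hom_eq.
- rewrite -fE; congr (f _ _ (e _ (phi _ _ _ _))).
  apply: Bar_mor_eq => /= [a a' l|a|a]; first exact: if_hom_eq.
  - by case: (_ == ord0).
  - by case: (_ == ord0) => //=; rewrite fmap_comp compA kap_nat.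
Qed.

Definition eps_homotopy n (x : holim D n) (r : delta_hom n 1) : holim D n :=
  exist _ _ (eps_natural x r).

Definition h_homotopy n (x : holim D n) (r : delta_hom n 1) : holim D n :=
  exist _ _ (h_natural x r).

Definition kap_homotopy n (x : holim D n) (r : delta_hom n 1) : holim D n :=
  exist _ _ (kap_natural x r).

Lemma eps_homotopy_sact m n (s : delta_hom m n) (x : holim D n) r :
  eps_homotopy (sact s x) (delta_comp r s) = sact s (eps_homotopy x r).
Proof. exact: whlim_eq. Qed.

Lemma h_homotopy_sact m n (s : delta_hom m n) (x : holim D n) r :
  h_homotopy (sact s x) (delta_comp r s) = sact s (h_homotopy x r).
Proof. exact: whlim_eq. Qed.

Lemma kap_homotopy_sact m n (s : delta_hom m n) (x : holim D n) r :
  kap_homotopy (sact s x) (delta_comp r s) = sact s (kap_homotopy x r).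
Proof. exact: whlim_eq. Qed.

(** One composite is the identity by [eK]. The other is the 1-end of the [kap] homotopy, which is
    run backwards to its 0-end; this is the 0-end of the [h] homotopy, whose 1-end is the 0-end of
    the [eps] homotopy, which ends at the identity. *)
Lemma to_lim_hequiv : hequiv to_lim.
Proof.
exists from_lim; split.
  have -> : scomp from_lim to_lim = sidm X; last exact: rst_refl.
  by apply: smap_eq => n x; rewrite /= sact_id eK.
have -> : sidm (holim D) = homotopy_end eps_homotopy_sact ord_max.
  apply: smap_eq => n x; apply: whlim_eq => j p b t.
  by rewrite /= cst_comp_delta mix1.
have -> : scomp to_lim from_lim = homotopy_end kap_homotopy_sact ord_max.
  apply: smap_eq => n x; apply: whlim_eq => j p b t /=.
  rewrite cst_comp_delta mix1 -!smap_nat.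
  case: x => phi [nat1 nat2] /=; rewrite -nat1.
  by congr (f _ _ (e _ (phi _ _ _ _))); exact: Bar_eq.
apply: rst_trans (homotopy_ends eps_homotopy_sact).
have -> : homotopy_end eps_homotopy_sact ord0 =
    homotopy_end h_homotopy_sact ord_max.
  apply: smap_eq => n [phi [nat1 nat2]]; apply: whlim_eq => j p b t /=.
  by rewrite !cst_comp_delta mix0 h1 nat2.
apply: rst_trans (homotopy_ends h_homotopy_sact).
(* By [h0] the contracted value lies in the image of [f], so [fE] absorbs [eps], while naturality of
   [phi] turns [kap] into [bar_push]. *)
have -> : homotopy_end h_homotopy_sact ord0 =
    homotopy_end kap_homotopy_sact ord0.
  apply: smap_eq => n [phi [nat1 nat2]]; apply: whlim_eq => j p b t /=.
  by rewrite !cst_comp_delta mix0 h0 nat2 -fE.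
exact/rst_sym/homotopy_ends.
Qed.

End Zigzag.

(** * Restricted right Kan extensions at an object of the subcategory *)

Section RanSub.
Variables (C : category) (F : psh C) (P : C -> Prop) (c : C) (Pc : P c).

(** An element [h] of Hom(-, c) is itself an arrow out of [c] in the opposite category, carrying
    [idm c] to [h]; hence the initial arrows are given by the identity function. *)
Definition ran_contraction :
    forall n, ran_sub F P c n -> delta_hom n 1 -> ran_sub F P c n :=
  @contraction (op (fullsub P)) (hom_weight (incl P) c)
    (dpull (fop (incl P)) F) (FsOb Pc) (idm c) (fun _ h => h)
    (fun _ h => comp1m h) (fun _ _ _ _ => erefl).

Definition ran_eval : smap (ran_sub F P c) (F c) :=
  @weval (op (fullsub P)) (hom_weight (incl P) c)
    (dpull (fop (incl P)) F) (FsOb Pc) (idm c).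

Lemma ran_eval_unit n (x : F c n) :
  ran_eval n (ran_unit (incl P) F c n x) = x.
Proof.
rewrite /= sact_id /ran_unit_cone /bar_aug /= compm1.
exact: (@dmap_id (op C) F).
Qed.

Lemma ran_contraction0 n (x : ran_sub F P c n) :
  ran_contraction x (cst_map n ord0) = ran_unit (incl P) F c n (ran_eval n x).
Proof. by apply: whlim_eq => j p b t; apply: contraction0. Qed.

End RanSub.

Section RanRestrict.
Variables (C : category) (F : psh C) (P Q : C -> Prop).
Variable PQ : forall x, P x -> Q x.
Variables (c : C) (Pc : P c) (Qc : Q c).

Lemma ran_eval_restrict n (x : ran_sub F Q c n) :
  ran_eval F Pc n (ran_restrict PQ F c n x) = ran_eval F Qc n x.
Proof.
have -> : Qc = PQ Pc by exact: Prop_irrelevance.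
case: x => phi phiP /=.
apply: (congr1 (fun b => phi (@FsOb C Q c (PQ Pc)) n b (delta_id n))).
exact: Bar_eq.
Qed.

(** Widening the index category preserves the initial object (c, id), so mixing before or after
    widening gives the same chain. *)
Lemma ran_contraction_restrict n (x : ran_sub F Q c n) (r : delta_hom n 1) :
  ran_contraction Pc (ran_restrict PQ F c n x) r =
  ran_restrict PQ F c n (ran_contraction Qc x r).
Proof.
have -> : Qc = PQ Pc by exact: Prop_irrelevance.
apply: whlim_eq => j p b t; case: x => phi phiP /=.
apply: (congr1 (fun b => phi (widen PQ j) p b t)).
(* [widen] commutes with the conditional only after a case split, hence the transport of [Bar_heq];
   in each case the equality of vertices becomes reflexivity. *)
have e (a : 'I_p.+1) : let y := delta_comp r t a == ord0 in
    widen PQ (if y then FsOb Pc else bob b a) =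
    if y then FsOb (PQ Pc) else widen PQ (bob b a).
  by case: (_ == ord0).
unshelve eapply Bar_heq; [exact: e| | |] => /= [a a' l|a|a].
- move: (e a) (e a') (mix_le (delta_comp r t) l) => /=.
  case: (r (t a) == ord0); case: (r (t a') == ord0) => //= ea ea' _;
    by rewrite (Prop_irrelevance ea erefl) (Prop_irrelevance ea' erefl).
- move: (e a) => /=; case: (r (t a) == ord0) => /= ea;
    by rewrite (Prop_irrelevance ea erefl).
- move: (e a) => /=; case: (r (t a) == ord0) => /= ea;
    by rewrite (Prop_irrelevance ea erefl).
Qed.

End RanRestrict.

(** * The tower at a fixed closed tree *)

Section Tower.
Variables (O : psh Omegac) (T : Omegac).

(** The 1 makes this an index of the tower even if every edge of [T] has valence 0. *)
Definition max_valence : nat := maxn 1 (\max_(e : fsval T) valence e).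

Lemma dendroidal_max_valence k : max_valence <= k -> dendroidal k T.
Proof.
move=> le_k e; apply: leq_trans le_k; rewrite leq_max; apply/orP; right.
exact: leq_bigmax.
Qed.

Lemma max_valence_gt0 k : 0 < maxn k max_valence.
Proof. by rewrite leq_max leq_maxl orbT. Qed.

Definition top_index : op Npos :=
  @FsOb leq_cat (fun k => 0 < k) max_valence (leq_maxl _ _).

Lemma clamp_hom (k l : op Npos) : hom k l ->
  maxn (fsval l) max_valence <= maxn (fsval k) max_valence.
Proof.
by move=> lk; rewrite geq_max leq_maxr leq_max (lk : fsval l <= fsval k).
Qed.

(** [T] is [clamp k]-dendroidal, so the tower is contractible onto O(T) there. Arrows of [op Npos]
    lower the index, so [clamp k] maps to both [k] and [top_index], as the zigzag requires. *)
Definition clamp : functor (op Npos) (op Npos).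
Proof.
refine (@Functor (op Npos) (op Npos)
  (fun k => @FsOb leq_cat (fun k => 0 < k) (maxn (fsval k) max_valence)
     (max_valence_gt0 _)) clamp_hom _ _).
- by move=> k; exact: bool_irrelevance.
- by move=> k l m g f; exact: bool_irrelevance.
Defined.

Lemma to_tower_limit_hequiv : hequiv (to_tower_limit O T).
Proof.
have dT (k : op Npos) : dendroidal (fsval (clamp k)) T.
  exact/dendroidal_max_valence/leq_maxr.
have dK : dendroidal (fsval top_index) T by exact: dendroidal_max_valence.
apply: (@to_lim_hequiv (op Npos) (pd_at (tower O) T) (O T)
  (fun k => tower_unit O (fsval k) T) _ top_index
  (ran_eval O dK) _ clamp (fun k => leq_maxl _ _) (fun k => leq_maxr _ _) _ _
  (fun k n x r => ran_contraction (dT k) x r)).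
- by move=> n x; exact: ran_eval_unit.
- by move=> k l lk; exact: bool_irrelevance.
- by move=> k l lk; exact: bool_irrelevance.
- by move=> k m n s x r; exact: contraction_sact.
- by move=> k l lk n x r; exact: ran_contraction_restrict.
- by move=> k n x; exact: contraction1.
(* The contraction ends at evaluation at stage [clamp k], which is restriction to [top_index]
   followed by evaluation there. *)
- move=> k n x; rewrite ran_contraction0; congr (tower_unit _ _ _ _ _).
  exact/esym/ran_eval_restrict.
Qed.

End Tower.

Theorem corollary5p22 (O : unital_operad) : psh_equiv (to_tower_limit O).
Proof. by move=> T; exact: to_tower_limit_hequiv. Qed.
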